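(* Let $n\geq 1$ and let $\mathcal F\subseteq\mathcal P([n])$ be a diamond-saturated family. Then $|\mathcal F|\geq\frac{n+1}{5}$.
   Context: $[n]=\{1,\dots,n\}$ and $\mathcal P([n])$ is its power set, ordered by inclusion. The diamond $\mathcal D_2$ is the 4-element poset with one minimal element, one maximal element and two incomparable middle elements (the Boolean lattice of dimension 2). A family $\mathcal F\subseteq\mathcal P([n])$ contains an induced copy of a poset $\mathcal P$ if there is an injection $f:\mathcal P\to\mathcal F$ such that $f(\mathcal P)$, ordered by inclusion, is isomorphic to $\mathcal P$ via $f$. For $\mathcal D_2$ this means there are distinct sets $R,P,Q,A\in\mathcal F$ with $R\subsetneq P\subsetneq A$, $R\subsetneq Q\subsetneq A$ and $P,Q$ incomparable. A family $\mathcal F\subseteq\mathcal P([n])$ is diamond-saturated if it contains no induced copy of $\mathcal D_2$, but for every $S\in\mathcal P([n])\setminus\mathcal F$ the family $\mathcal F\cup\{S\}$ contains an induced copy of $\mathcal D_2$. *)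

(* Defs.v *)
From mathcomp Require Import all_boot all_order all_algebra.

Import Order.DefaultSetSubsetOrder.

Set Implicit Arguments.
Unset Strict Implicit.
Unset Printing Implicit Defensive.

Definition induced_copy (d : Order.disp_t) (P : porderType d) (n : nat)
    (F : {set {set 'I_n}}) : Prop :=
  exists f : P -> {set 'I_n},
    [/\ injective f,
        (forall x : P, f x \in F) &
        (forall x y : P, (f x \subset f y) = (x <= y)%O)].

(* The diamond is the Boolean lattice {set 'I_2}; its inclusion order comes
   from DefaultSetSubsetOrder. *)
Definition diamond : porderType _ := {set 'I_2}.

Definition diamond_saturated (n : nat) (F : {set {set 'I_n}}) : Prop :=
  ~ induced_copy diamond F /\
  (forall S : {set 'I_n}, S \notin F -> induced_copy diamond (S |: F)).

Lemma induced_diamondP (n : nat) (F : {set {set 'I_n}}) :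
  induced_copy diamond F <->
  exists R P Q A : {set 'I_n},
    [/\ [/\ R \in F, P \in F, Q \in F & A \in F],
        R \proper P /\ P \proper A,
        R \proper Q /\ Q \proper A &
        ~~ (P \subset Q) /\ ~~ (Q \subset P)].
Proof.
have o10 : (lift ord0 ord0 : 'I_2) != ord0 by [].
split.
  case=> f [_ fF fle].
  have fs (X Y : {set 'I_2}) : (f X \subset f Y) = (X \subset Y).
    by rewrite fle Order.SetSubsetOrder.leEsubset.
  exists (f set0), (f [set ord0]), (f [set lift ord0 ord0]), (f setT).
  have pr (X Y : {set 'I_2}) : X \proper Y -> f X \proper f Y.
    by rewrite !properE !fs.
  split; first by split; apply: fF.
  - by split; apply: pr; rewrite properEcard ?sub0set ?subsetT ?cards0 ?cards1 ?cardsT ?card_ord.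
  - by split; apply: pr; rewrite properEcard ?sub0set ?subsetT ?cards0 ?cards1 ?cardsT ?card_ord.
  - by rewrite !fs !sub1set !inE.
case=> R [P [Q [A [[RF PF QF AF] [RP PA] [RQ QA] [nPQ nQP]]]]].
pose g (X : {set 'I_2}) : {set 'I_n} :=
  if ord0 \in X then (if lift ord0 ord0 \in X then A else P)
  else (if lift ord0 ord0 \in X then Q else R).
have sub2 (X Y : {set 'I_2}) : (X \subset Y) =
  ((ord0 \in X) ==> (ord0 \in Y)) &&
  ((lift ord0 ord0 \in X) ==> (lift ord0 ord0 \in Y)).
  apply/subsetP/andP => [sXY | [/implyP s0 /implyP s1] i].
    by split; apply/implyP; apply: sXY.
  by case: (unliftP ord0 i) => [j|] -> //; rewrite [j]ord1.
have RA := proper_trans RP PA.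
have gs X Y : (g X \subset g Y) = (X \subset Y).
  rewrite sub2 /g.
  case: (ord0 \in X); case: (lift ord0 ord0 \in X);
  case: (ord0 \in Y); case: (lift ord0 ord0 \in Y);
  rewrite /= ?subxx //; try (by rewrite proper_sub);
  by apply/negbTE => //; move: RP PA RQ QA RA; rewrite !properE;
     do ![case/andP=> _ ?].
exists g; split.
- by move=> X Y eXY; apply/eqP; rewrite eqEsubset -!gs eXY subxx.
- by move=> X; rewrite /g; case: ifP => _; case: ifP => _.
- by move=> X Y; rewrite gs Order.SetSubsetOrder.leEsubset.
Qed.

(* Main.v *)
Require Import Defs.
From mathcomp Require Import all_boot all_order all_algebra.
From mathcomp Require Import zify.
Local Open Scope ring_scope.

Set Implicit Arguments.
Unset Strict Implicit.
Unset Printing Implicit Defensive.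

(** Let B and A be the families of minimal and maximal members of F.
    Saturation forces every set containing no member of F to lie in P :&: Q for
    two members P, Q of F whose intersection again contains no member of F.
    A Hall-type argument (as in Tarsi's lemma on minimally unsatisfiable
    formulas) then bounds the union of B by #|B| + #|F|, and dually the union
    of the complements of A.  Any other point x lies in every maximal and in no
    minimal member; a member C of F maximal subject to x \notin C then
    satisfies x |: C \in F, and pairs differing in exactly one point, with
    distinct points, form a forest on F, so there are fewer than #|F| of them.
    In total n <= 2 #|F| + 2 #|F| + (#|F| - 1). *)

(** * Hall's theorem and its deficiency version *)

Section Hall.
Variables (C V : finType).
Implicit Types (N : C -> {set V}) (D E : {set C}).

Definition neighbours N D : {set V} := \bigcup_(c in D) N c.

Lemma neighboursU N D E :
  neighbours N (D :|: E) = neighbours N D :|: neighbours N E.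
Proof. exact: bigcup_setU. Qed.

Lemma neighboursD N (W : {set V}) D :
  neighbours (fun c => N c :\: W) D = neighbours N D :\: W.
Proof.
apply/setP=> v; rewrite in_setD; apply/bigcupP/andP.
  by case=> c cD; rewrite in_setD => /andP[-> vN]; split=> //; apply/bigcupP; exists c.
by case=> vW /bigcupP[c cD vN]; exists c => //; rewrite in_setD vW.
Qed.

Lemma sub_neighbours N D c : c \in D -> N c \subset neighbours N D.
Proof. by move=> cD; apply: bigcup_sup. Qed.

(** Induction on [#|D|]: a tight proper nonempty subset is matched first and its neighbours are
    removed for the rest; if there is none, any point of [N c0] can serve [c0]. The default [v0] is
    used when [D] is empty. *)
Lemma Hall_matching (v0 : V) N D :
  (forall E, E \subset D -> #|E| <= #|neighbours N E|)%N ->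
  exists2 f : C -> V, {in D &, injective f} & {in D, forall c, f c \in N c}.
Proof.
have [k] := ubnP #|D|; elim: k => // k IH in D N *.
rewrite ltnS => leDk hall.
have [D0|[c0 c0D]] := set_0Vmem D.
  by exists (fun=> v0) => [x y|x]; rewrite D0 inE.
have [/existsP[E /and4P[ED E0 EnD tightE]]|noTight] :=
    boolP [exists E : {set C},
      [&& E \subset D, E != set0, E != D & #|E| == #|neighbours N E|]].
  have ltED : (#|E| < #|D|)%N by apply: proper_card; rewrite properEneq EnD.
  have [||f finj fN] := IH E N.
  - exact: leq_trans ltED leDk.
  - by move=> G GE; apply: hall; apply: subset_trans GE ED.
  have ltDE : (#|D :\: E| < #|D|)%N.
    have := cardsID E D; rewrite (setIidPr ED); move: E0; rewrite -card_gt0; lia.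
  have [||g ginj gN] := IH (D :\: E) (fun c => N c :\: neighbours N E).
  - exact: leq_trans ltDE leDk.
  - move=> G /subsetDP[GD dGE]; rewrite neighboursD.
    have := hall (E :|: G); rewrite subUset ED GD => /(_ isT).
    rewrite neighboursU cardsU disjoint_setI0 1?disjoint_sym // cards0 subn0.
    have := cardsU (neighbours N E) (neighbours N G).
    have := cardsID (neighbours N E) (neighbours N G).
    rewrite (setIC (neighbours N G)).
    have := subset_leq_card (subsetIl (neighbours N E) (neighbours N G)).
    have := eqP tightE; lia.
  have fE c : c \in E -> f c \in neighbours N E.
    by move=> cE; apply: subsetP (sub_neighbours N cE) _ (fN _ cE).
  have gE c : c \in D -> c \notin E -> g c \notin neighbours N E.
    by move=> cD cE; have := gN c; rewrite !inE cE cD => /(_ isT) /andP[].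
  exists (fun c => if c \in E then f c else g c) => [x y xD yD|x xD].
    case: ifPn => xE; case: ifPn => yE.
    - exact: finj.
    - by move=> e; have := gE _ yD yE; rewrite -e fE.
    - by move=> e; have := gE _ xD xE; rewrite e fE.
    - by apply: ginj; rewrite !inE ?xE ?yE.
  case: ifPn => xE; first exact: fN.
  by have := gN x; rewrite !inE xE xD => /(_ isT) /andP[].
have /card_gt0P[v vN] : (0 < #|N c0|)%N.
  have := hall [set c0]; rewrite sub1set c0D cards1 => /(_ isT).
  by rewrite /neighbours big_set1.
have ltD : (#|D :\ c0| < #|D|)%N by rewrite (cardsD1 c0 D) c0D.
have [||g ginj gN] := IH (D :\ c0) (fun c => N c :\: [set v]).
- exact: leq_trans ltD leDk.
- move=> G GD; rewrite neighboursD.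
  have [->|G0] := eqVneq G set0; first by rewrite cards0.
  have /subsetD1P[GsD c0G] := GD.
  (* [G] is not tight, and the strict inequality pays for the loss of [v]. *)
  move: noTight; rewrite negb_exists => /forallP/(_ G).
  rewrite GsD G0 /=; have -> /= : G != D by apply: contraNneq c0G => ->.
  have := hall _ GsD; have := cardsD1 v (neighbours N G); lia.
exists (fun c => if c == c0 then v else g c) => [x y xD yD|x xD].
  have gv z : z \in D -> z != c0 -> g z != v.
    by move=> zD zc; have := gN z; rewrite !inE zc zD => /(_ isT) /andP[].
  case: eqVneq => [->|xc]; case: eqVneq => [->|yc] //.
  - by move=> e; have := gv _ yD yc; rewrite e eqxx.
  - by move=> e; have := gv _ xD xc; rewrite e eqxx.
  - by apply: ginj; rewrite !inE ?xc ?yc.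
case: eqVneq => [->|xc] //.
by have := gN x; rewrite !inE xc xD => /(_ isT) /andP[].
Qed.

(** [E] maximises [#|E| - #|neighbours N E|], shifted by [#|V|] to stay in [nat]. Comparison with
    [set0] gives its inequality, comparison with [E :|: G] gives Hall's condition outside [E]. *)
Lemma deficient_or_matched (v0 : V) N D :
  exists E, [/\ E \subset D, (#|neighbours N E| <= #|E|)%N &
    exists2 f : C -> V, {in D :\: E &, injective f} &
      {in D :\: E, forall c, f c \in N c :\: neighbours N E}].
Proof.
pose surplus E := (#|E| + #|~: neighbours N E|)%N.
case: (@arg_maxnP _ set0 (fun E => E \subset D) surplus); first exact: sub0set.
move=> E ED Emax; exists E; split=> //.
  have := Emax set0 (sub0set _); rewrite /surplus /neighbours big_set0 cards0.
  rewrite setC0 cardsT -(cardsC (neighbours N E)) /neighbours; lia.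
apply: Hall_matching => // G /subsetDP[GD dGE]; rewrite neighboursD.
have := Emax (E :|: G); rewrite subUset ED GD => /(_ isT).
rewrite /surplus neighboursU cardsU disjoint_setI0 1?disjoint_sym // cards0 subn0.
set X := neighbours N E; set Y := neighbours N G.
have := cardsC X; have := cardsC (X :|: Y).
have := cardsU X Y; have := cardsID X Y; rewrite (setIC Y X).
have := subset_leq_card (subsetIl X Y); lia.
Qed.

End Hall.

(** * Covering bound from unsatisfiable constraints; unit steps *)

Section Covers.
Variable T : finType.
Implicit Types (S P Q : {set T}) (U F : {set {set T}}).

Definition above U S := [exists R in U, R \subset S].

Lemma aboveP U S : reflect (exists2 R, R \in U & R \subset S) (above U S).
Proof. exact: exists_inP. Qed.

Lemma card_cover_le U F :
  {in U &, forall R S : {set T}, R \subset S -> R = S} ->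
  (forall S, ~~ above U S -> exists P Q, [/\ P \in F, Q \in F,
     S \subset P :&: Q & ~~ above U (P :&: Q)]) ->
  (#|cover U| <= #|U| + #|F|)%N.
Proof.
move=> anti two.
have [->|[v0 _]] := set_0Vmem (cover U); first by rewrite cards0.
(* Constraint [inl R] asks a set to miss a point of [R], and [inr P] asks it to have a point outside
   [P]; [N] lists the points able to do so. By [two], no set meets all constraints. *)
pose N (c : {set T} + {set T}) := match c with inl R => R | inr P => ~: P end.
pose D := inl @: U :|: inr @: F.
have inlD R : (inl R \in D) = (R \in U).
  rewrite inE mem_imset; last by move=> ? ? [].
  by case: imsetP => [[]//|_]; rewrite orbF.
have inrD P : (inr P \in D) = (P \in F).
  rewrite inE [inr P \in inr @: _]mem_imset; last by move=> ? ? [].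
  by case: imsetP => [[]//|_].
have [E [ED leNE [f finj fN]]] := deficient_or_matched v0 N D.
set W := neighbours N E in leNE fN.
(* The points matched to constraints outside E are distinct and outside W, so
   adding [free] to a subset of W leaves every P outside E and completes no R
   outside E. *)
pose free := [set f (inr P) | P in F & inr P \notin E].
have fN' c : c \in D -> c \notin E -> f c \in N c /\ f c \notin W.
  by move=> cD cE; have := fN c; rewrite !in_setD cE cD => /(_ isT) /andP[].
have freeW v : v \in free -> v \notin W.
  case/imsetP=> P; rewrite inE => /andP[PF PE] ->.
  by case: (fN' (inr P)); rewrite ?inrD.
(* [S :|: free] contains no member of [U], so [two] puts it inside some [P :&: Q]; both sets then
   contain [~: W]. *)
have lift S : S \subset W -> ~~ above [set R in U | inl R \in E] S ->
    ~~ above U (S :|: ~: W).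
  move=> SW nS.
  have /two[P [Q [PF QF sPQ nPQ]]] : ~~ above U (S :|: free).
    apply/negP=> /aboveP[R RU /subsetP sR].
    have [RE|RE] := boolP (inl R \in E).
      move/negP: nS; apply; apply/aboveP; exists R; first by rewrite inE RU.
      apply/subsetP=> v vR; have := sR v vR; rewrite inE => /orP[//|/freeW/negP[]].
      exact: subsetP (sub_neighbours N RE) v vR.
    have [||fR fW] := fN' (inl R); rewrite ?inlD //.
    have := sR _ fR; rewrite inE => /orP[/(subsetP SW)|]; first by rewrite (negPf fW).
    case/imsetP=> P; rewrite inE => /andP[PF PE] /finj.
    by rewrite !in_setD inlD inrD RE PE => /(_ RU PF).
  (* Either [~: P'] lies in [W], or the point matched to [P'] is in [free] but not in [P'], which is
     impossible. *)
  have outW P' : P' \in F -> S :|: free \subset P' -> ~: W \subset P'.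
    move=> PF' /subsetP sP; have [PE|PE] := boolP (inr P' \in E).
      by rewrite -[P']setCK setCS; apply: (sub_neighbours N PE).
    have [||fP _] := fN' (inr P'); rewrite ?inrD //.
    move: fP; rewrite inE => /negP[]; apply: sP; rewrite inE; apply/orP; right.
    by apply/imsetP; exists P'; rewrite // inE PF'.
  move: sPQ; rewrite subsetI => /andP[sP sQ].
  apply: contra nPQ => /aboveP[R RU sR]; apply/aboveP; exists R => //.
  apply: subset_trans sR _; rewrite subsetI !subUset !outW // !andbT.
  by rewrite (subset_trans (subsetUl _ _) sP) (subset_trans (subsetUl _ _) sQ).
have UE R : R \in U -> inl R \in E.
  (* If [R] is outside [E], the antichain condition lets [lift] apply to [R :&: W], yet adding
     [~: W] to it recovers all of [R]. *)
  move=> RU; apply: contraT => RE.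
  have /negP[] : ~~ above U ((R :&: W) :|: ~: W).
    apply: lift; first exact: subsetIr.
    apply/negP=> /aboveP[R']; rewrite inE => /andP[RU' RE'].
    rewrite subsetI => /andP[/(anti _ _ RU' RU) eR _].
    by move: RE; rewrite -eR RE'.
  apply/aboveP; exists R => //; apply/subsetP=> v vR.
  by rewrite !inE vR /= orbN.
have le1 : (#|cover U| <= #|W|)%N.
  apply/subset_leq_card/bigcupsP=> R RU.
  exact: (sub_neighbours N (UE _ RU)).
apply: leq_trans le1 (leq_trans leNE (leq_trans (subset_leq_card ED) _)).
by rewrite cardsU (leq_trans (leq_subr _ _)) // leq_add // leq_imset_card.
Qed.

(** Deleting a point [x] of [X] from all members identifies some [C] with [x |: C], so the family
    shrinks, while the steps at other points survive. *)
Lemma card_unit_steps (X : {set T}) F : F != set0 ->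
  {in X, forall x, exists C, [/\ C \in F, x \notin C & x |: C \in F]} ->
  (#|X| < #|F|)%N.
Proof.
have [k] := ubnP #|X|; elim: k => // k IH in X F *.
rewrite ltnS => leXk F0 steps.
have [->|[x xX]] := set_0Vmem X; first by rewrite cards0 card_gt0.
pose proj C := C :\ x.
have ltX : (#|X :\ x| < #|X|)%N by rewrite (cardsD1 x X) xX.
have ltF : (#|proj @: F| < #|F|)%N.
  rewrite ltn_neqAle leq_imset_card andbT; apply/negP=> /imset_injP inj.
  have [C [CF xC xCF]] := steps x xX.
  have e : C = x |: C.
    apply: inj => //; rewrite /proj; apply/setP=> y; rewrite !inE.
    by case: eqVneq.
  by move: xC; rewrite e setU11.
have := IH (X :\ x) (proj @: F) (leq_trans ltX leXk).
rewrite (cardsD1 x X) xX => IHx.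
suff : (#|X :\ x| < #|proj @: F|)%N by lia.
apply: IHx.
  have [C CF] := set0Pn _ F0; apply/set0Pn; exists (proj C); exact: imset_f.
move=> y; rewrite !inE => /andP[yx yX].
have [C [CF yC yCF]] := steps y yX.
exists (proj C); split; first exact: imset_f.
  by rewrite !inE negb_and yC orbT.
have -> : y |: proj C = proj (y |: C); last exact: imset_f.
apply/setP=> z; rewrite !inE; case: (eqVneq z y) => // ->.
by rewrite (negPf yx).
Qed.

End Covers.

(** * Diamonds created by adding one set *)

Section Diamonds.
Variable T : finType.
Implicit Types (R P Q A S C : {set T}) (F : {set {set T}}).

Definition is_diamond R P Q A :=
  [/\ R \proper P /\ P \proper A, R \proper Q /\ Q \proper A &
      ~~ (P \subset Q) /\ ~~ (Q \subset P)].

Definition diamond_in F := exists R P Q A,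
  [/\ R \in F, P \in F, Q \in F & A \in F] /\ is_diamond R P Q A.

Definition saturated F :=
  ~ diamond_in F /\ forall S, S \notin F -> diamond_in (S |: F).

Lemma is_diamond_sym R P Q A : is_diamond R P Q A -> is_diamond R Q P A.
Proof. by case=> ? ? []. Qed.

(** Strictness at the bottom follows from incomparability: [P \subset R] would give
    [P \subset Q]. *)
Lemma is_diamondI R P Q A :
  R \subset P -> R \subset Q -> P \proper A -> Q \proper A ->
  ~~ (P \subset Q) -> ~~ (Q \subset P) -> is_diamond R P Q A.
Proof.
move=> RP RQ PA QA nPQ nQP; split=> //; split=> //; rewrite properE ?RP ?RQ /=.
  by apply: contra nPQ => PR; apply: subset_trans PR RQ.
by apply: contra nQP => QR; apply: subset_trans QR RP.
Qed.

(** A diamond avoiding [S] would lie in [F]; the two middle positions are merged by symmetry. *)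
Lemma diamond_inU1 F S : ~ diamond_in F -> diamond_in (S |: F) ->
  [\/ exists P Q A, [/\ P \in F, Q \in F & A \in F] /\ is_diamond S P Q A,
      exists R Q A, [/\ R \in F, Q \in F & A \in F] /\ is_diamond R S Q A |
      exists R P Q, [/\ R \in F, P \in F & Q \in F] /\ is_diamond R P Q S].
Proof.
move=> free [R [P [Q [A [[RF PF QF AF] dia]]]]].
have [[RP PA] [RQ QA] [nPQ nQP]] := dia.
have inF X : X \in S |: F -> X != S -> X \in F.
  by rewrite !inE => /orP[->|].
have neq (X Y : {set T}) : X \proper Y -> X != Y.
  by move=> XY; apply: contraTneq XY => ->; rewrite properxx.
have RA := neq _ _ (proper_trans RP PA).
have PQ : P != Q by apply: contraNneq nPQ => ->.
have [RS|RS] := eqVneq R S.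
  constructor 1; exists P, Q, A; rewrite -RS; split=> //.
  by split; apply: inF; rewrite // -RS eq_sym ?RA // neq.
have [AS|AS] := eqVneq A S.
  constructor 3; exists R, P, Q; rewrite -AS; split=> //.
  by split; apply: inF; rewrite // -AS ?RA // neq.
have [PS|PS] := eqVneq P S.
  constructor 2; exists R, Q, A; rewrite -PS; split=> //.
  by split; apply: inF => //; rewrite -PS eq_sym.
have [QS|QS] := eqVneq Q S.
  constructor 2; exists R, P, A; rewrite -QS; split; last exact: is_diamond_sym.
  by split; apply: inF.
by case: free; exists R, P, Q, A; split=> //; split; apply: inF.
Qed.

(** * Minimal members and the points they cover *)

Definition minimal F := [set R in F | [forall S in F, (S \subset R) ==> (S == R)]].

Lemma minimal_antichain F :
  {in minimal F &, forall R S : {set T}, R \subset S -> R = S}.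
Proof.
move=> R S; rewrite !inE => /andP[RF _] /andP[_ /forall_inP/(_ R RF)].
by move=> /implyP h /h /eqP.
Qed.

Lemma minimal_below F C : C \in F -> exists2 R, R \in minimal F & R \subset C.
Proof.
move=> CF; have : (fun S => S \in F) C by [].
case/(@minset_exists _ (fun S => S \in F)) => R /minsetP[RF Rmin] RC.
exists R => //; rewrite inE RF; apply/forall_inP=> S SF.
by apply/implyP=> SR; rewrite (Rmin S).
Qed.

Lemma above_minimal F S : above (minimal F) S = above F S.
Proof.
apply/aboveP/aboveP=> [[R]|[C /minimal_below[R Rm RC] CS]].
  by rewrite inE => /andP[RF _] RS; exists R.
by exists R => //; apply: subset_trans RC CS.
Qed.

(** No member lies inside [S], so [S] is the bottom of the new diamond, with middle sets [P] and
    [Q]. A member inside [P :&: Q] could replace [S] and give a diamond in [F]. *)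
Lemma saturated_not_above F S : saturated F -> ~~ above F S ->
  exists P Q, [/\ P \in F, Q \in F, S \subset P :&: Q & ~~ above F (P :&: Q)].
Proof.
move=> [free sat] nS.
have noR R : R \in F -> R \proper S -> False.
  by move=> RF /proper_sub RS; move/negP: nS; apply; apply/aboveP; exists R.
have /sat/(diamond_inU1 free)[] : S \notin F.
- by apply: contra nS => SF; apply/aboveP; exists S.
- case=> P [Q [A [[PF QF AF] [[SP PA] [SQ QA] [nPQ nQP]]]]].
  exists P, Q; split=> //; first by rewrite subsetI !proper_sub.
  apply/negP=> /aboveP[R RF]; rewrite subsetI => /andP[RP RQ].
  by case: free; exists R, P, Q, A; split=> //; apply: is_diamondI.
- by case=> R [Q [A [[RF _ _] [[/noR []//]]]]].
- case=> R [P [Q [[RF _ _] [[RP PS] _ _]]]].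
  by case: (noR R RF); apply: proper_trans PS.
Qed.

Lemma card_cover_minimal F : saturated F ->
  (#|cover (minimal F)| <= 2 * #|F|)%N.
Proof.
move=> sat; have le : (#|minimal F| <= #|F|)%N.
  by apply: subset_leq_card; apply/subsetP=> R; rewrite inE => /andP[].
apply: leq_trans (card_cover_le (F := F) (@minimal_antichain F) _) _; last by lia.
move=> S; rewrite above_minimal => /(saturated_not_above sat)[P [Q h]].
by exists P, Q; rewrite above_minimal.
Qed.

(** * Complement duality, unit steps at the remaining points, and the count *)

Definition complements F := [set ~: C | C in F].

Lemma mem_complements F C : (C \in complements F) = (~: C \in F).
Proof. by rewrite -{1}[C]setCK mem_imset //; apply: setC_inj. Qed.

Lemma card_complements F : #|complements F| = #|F|.
Proof. exact/card_imset/setC_inj. Qed.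

Lemma complementsK F : complements (complements F) = F.
Proof. by apply/setP=> C; rewrite !mem_complements setCK. Qed.

Lemma diamond_in_complements F : diamond_in F -> diamond_in (complements F).
Proof.
case=> R [P [Q [A [[RF PF QF AF] [[RP PA] [RQ QA] [nPQ nQP]]]]]].
exists (~: A), (~: P), (~: Q), (~: R); rewrite !mem_complements !setCK.
by split=> //; split; rewrite ?properC ?setCK ?setCS.
Qed.

Lemma saturated_complements F : saturated F -> saturated (complements F).
Proof.
move=> [free sat]; split.
  by move/diamond_in_complements; rewrite complementsK.
move=> S; rewrite mem_complements => /sat/diamond_in_complements.
suff -> : complements (~: S |: F) = S |: complements F by [].
apply/setP=> C; rewrite !inE !mem_complements !inE.
by rewrite (inj_eq (@setC_inj T)).
Qed.

(** Take [C] maximal among members omitting [x]. If [x |: C] were new, its diamond could be moved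
    into [F]: [C] replaces it as bottom or middle set, a larger member containing [x] replaces it as
    top. *)
Lemma saturated_unit_step F x : F != set0 -> saturated F ->
  x \notin cover (minimal F) -> x \notin cover (minimal (complements F)) ->
  exists C, [/\ C \in F, x \notin C & x |: C \in F].
Proof.
move=> F0 [free sat] xmin xmax.
have notmin R : R \in minimal F -> x \notin R.
  by move=> Rm; apply: contra xmin => xR; apply/bigcupP; exists R.
have top C : C \in F -> exists A, [/\ A \in F, C \subset A & x \in A].
  move=> CF; have : ~: C \in complements F by rewrite mem_complements setCK.
  case/minimal_below=> B Bm BC; exists (~: B); split.
  - by move: Bm; rewrite inE mem_complements => /andP[].
  - by rewrite -[C]setCK setCS.
  - by rewrite inE; apply: contra xmax => xB; apply/bigcupP; exists B.
have [C1 C1F] := set0Pn _ F0; have [R1 R1m _] := minimal_below C1F.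
pose p C := (C \in F) && (x \notin C).
have pR1 : p R1.
  by rewrite /p notmin // andbT; move: R1m; rewrite inE => /andP[].
have [C /maxsetP[/andP[CF xC] Cmax] _] := maxset_exists pR1.
exists C; split=> //; apply: contraT => nS.
have CS : C \subset x |: C by apply: subsetUr.
case/(diamond_inU1 free): (sat _ nS) => h; case: free; move: h.
- case=> P [Q [A [[PF QF AF] [[SP PA] [SQ QA] [nPQ nQP]]]]].
  exists C, P, Q, A; split=> //.
  apply: is_diamondI => //; apply: subset_trans CS _; exact: proper_sub.
- case=> R [Q [A [[RF QF AF] [[RS SA] [RQ QA] [nSQ nQS]]]]].
  (* [R] may contain [x]; a minimal member below it does not, hence lies in [C]. *)
  have [R0 R0m R0R] := minimal_below RF.
  have R0F : R0 \in F by move: R0m; rewrite inE => /andP[].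
  exists R0, C, Q, A; split=> //; apply: is_diamondI => //.
  + apply/subsetP=> y yR0.
    have := subsetP (proper_sub RS) y (subsetP R0R y yR0).
    rewrite !inE; case: eqVneq => // yx; move: yR0.
    by rewrite yx (negPf (notmin _ R0m)).
  + exact: subset_trans R0R (proper_sub RQ).
  + exact: sub_proper_trans CS SA.
  (* If [Q] contained [x] it would contain [x |: C]; so it omits [x], and maximality of [C] forces
     [Q = C]. *)
  + apply: contra nQS => CQ.
    suff -> : Q = C by [].
    apply: Cmax => //; rewrite /p QF; apply: contra nSQ => xQ.
    by rewrite subUset sub1set xQ.
  + by apply: contra nQS => /subset_trans; apply.
- case=> R [P [Q [[RF PF QF] [[RP PS] [RQ QS] [nPQ nQP]]]]].
  have [A [AF CA xA]] := top C CF.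
  have SA : x |: C \subset A by rewrite subUset sub1set xA.
  exists R, P, Q, A; split=> //; apply: is_diamondI => //.
  + exact: proper_sub.
  + exact: proper_sub.
  + exact: proper_sub_trans SA.
  + exact: proper_sub_trans SA.
Qed.

Lemma saturated_neq0 F : saturated F -> F != set0.
Proof.
case=> free sat; apply/eqP=> F0.
have /sat/(diamond_inU1 free) : set0 \notin F by rewrite F0 inE.
by case; case=> X [Y [Z [[]]]]; rewrite F0 inE.
Qed.

Lemma saturated_card F : saturated F -> (#|T| < 5 * #|F|)%N.
Proof.
move=> satF; have F0 := saturated_neq0 satF.
have := card_cover_minimal satF.
have := card_cover_minimal (saturated_complements satF).
rewrite card_complements.
set W := cover (minimal (complements F)); set Y := cover (minimal F).
(* The strict inequality here is the source of the [+ 1] in the final bound. *)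
have : (#|~: (Y :|: W)| < #|F|)%N.
  apply: card_unit_steps => // x; rewrite !inE negb_or => /andP[xY xW].
  exact: saturated_unit_step.
have := cardsC (Y :|: W); have := cardsU Y W; lia.
Qed.

End Diamonds.

(** * Transfer to induced copies and rational numbers *)

Lemma diamond_inE (n : nat) (F : {set {set 'I_n}}) :
  induced_copy diamond F <-> diamond_in F.
Proof.
split=> [/induced_diamondP|] [R [P [Q [A h]]]].
  by exists R, P, Q, A; case: h.
by apply/induced_diamondP; exists R, P, Q, A; case: h => ? [].
Qed.

Theorem theorem1 (n : nat) (hn : (1 <= n)%N) (F : {set {set 'I_n}})
    (hF : diamond_saturated F) :
  (n%:R + 1) / 5%:R <= #|F|%:R :> rat.
Proof.
have satF : saturated F.
  by case: hF => free sat; split=> [/diamond_inE|S /sat /diamond_inE].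
have := saturated_card satF; rewrite card_ord => le.
rewrite Num.Theory.ler_pdivrMr // GRing.natr1 -GRing.natrM Num.Theory.ler_nat; lia.
Qed.
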